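(* Let $(X,\mathcal{F},\mu)$ be a finite positive measure space and let $\{\psi_{j,k}(x): j,k=1,2,\dots\}$ be an orthonormal system of real-valued functions in $L^2(X,\mathcal{F},\mu)$. Let $\{c_{j,k}: j,k=1,2,\dots\}$ be real numbers such that $$\sum_{j=1}^{\infty}\sum_{k=1}^{\infty}c_{j,k}^2\,[\log\log(j+3)]^2\,[\log\log(k+3)]^2<\infty .$$ Let $s_{m,n}(x)=\sum_{j=1}^{m}\sum_{k=1}^{n}c_{j,k}\psi_{j,k}(x)$ for $m,n=1,2,\dots$, and let $g\in L^2(X,\mathcal{F},\mu)$ be the $L^2$-sum of the series $\sum_{j,k}c_{j,k}\psi_{j,k}$, i.e. $\lim_{m,n\to\infty}\int_X|s_{m,n}(x)-g(x)|^2\,d\mu(x)=0$. Then the series is strongly Cesàro $|C,1,1|$ summable almost everywhere to $g$, that is, $$\frac{1}{MN}\sum_{m=1}^{M}\sum_{n=1}^{N}|s_{m,n}(x)-g(x)|^2\to 0\quad\text{for }\mu\text{-almost every }x\in X,\ \text{as }M,N\to\infty.$$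
   Context: Here $M,N\to\infty$ means that both $M$ and $N$ tend to infinity (convergence in Pringsheim's sense, i.e. as $\min(M,N)\to\infty$). Logarithms are to base 2. The orthonormal system is what the paper calls a wavelet system; only orthonormality is used. *)

(* Defs.v *)
From HB Require Import structures.
From mathcomp Require Import all_boot all_order all_algebra.
From mathcomp Require Import all_classical all_reals all_analysis.
Set Implicit Arguments. Unset Strict Implicit. Unset Printing Implicit Defensive.
Import Order.TTheory GRing.Theory Num.Theory.
Local Open Scope ring_scope.

Definition log2 {R : realType} (x : R) : R := ln x / ln 2.

Definition llw {R : realType} (j : nat) : R := log2 (log2 (j%:R + 3)).

Definition psum {T : Type} {R : realType} (c : nat -> nat -> R)
  (psi : nat -> nat -> T -> R) (m n : nat) (x : T) : R :=
  \sum_(1 <= j < m.+1) \sum_(1 <= k < n.+1) c j k * psi j k x.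

Definition cesaro_mean {T : Type} {R : realType} (c : nat -> nat -> R)
  (psi : nat -> nat -> T -> R) (g : T -> R) (M N : nat) (x : T) : R :=
  (M%:R * N%:R)^-1 *
  \sum_(1 <= m < M.+1) \sum_(1 <= n < N.+1) `|psum c psi m n x - g x| ^+ 2.

(* Main.v *)
Require Import Defs.
From HB Require Import structures.
From mathcomp Require Import all_boot all_order all_algebra.
From mathcomp Require Import all_classical all_reals all_analysis.
From mathcomp Require Import measurable_realfun ring lra zify.
Set Implicit Arguments. Unset Strict Implicit. Unset Printing Implicit Defensive.
Import Order.TTheory GRing.Theory Num.Theory.
Local Open Scope ring_scope.

(** In one variable there is, for each range of [M], a finite family of weighted
intervals such that every real sequence satisfies
  [1/M * sum_(m <= M) (a_1 + ... + a_m)^2 <= sum_i w_i (sum_(j in I_i) a_j)^2],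
while the weights of the intervals containing [j] add up to [O((log log j)^2)].
(Rademacher-Menshov along the powers of 2, and weights [1/m] for the rest.)  Being
pointwise, this tensorizes: used in both variables and integrated with the help of
orthogonality, it bounds the maximal function of the double strong means by a
constant times the weighted sum of the [c_jk^2], uniformly in the range of [M, N].
Almost everywhere convergence then follows by approximating the series by its
square partial sums. *)

(** * One-dimensional strong means *)

Section WeightedIntervals.
Variable R : realFieldType.
Implicit Types (L : seq (R * nat * nat)) (G : nat -> nat -> R) (f b : nat -> R).

Definition isum f (l h : nat) : R := \sum_(l <= j < h) f j.
Definition isum_sqr f (l h : nat) : R := isum f l h ^+ 2.

(* A triple [(w, l, h)] stands for the interval [l <= j < h] with weight [w]. *)
Definition wsum L G : R := \sum_(q <- L) q.1.1 * G q.1.2 q.2.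
Definition wscale (a : R) L := [seq (a * q.1.1, q.1.2, q.2) | q <- L].
(** Left endpoints stay positive because orthonormality is available only for indices from 1 on. *)
Definition wpos L := all (fun q => (0 <= q.1.1) && (0 < q.1.2)%N) L.

Lemma isum_cat f l m h : (l <= m)%N -> (m <= h)%N ->
  isum f l h = isum f l m + isum f m h.
Proof. exact: big_cat_nat. Qed.

Lemma isum_ge0 b l h : (forall j, 0 <= b j) -> 0 <= isum b l h.
Proof. by move=> b0; apply: sumr_ge0. Qed.

Lemma isum_sqr_ge0 f l h : 0 <= isum_sqr f l h.
Proof. exact: sqr_ge0. Qed.

Lemma wsum_cat L1 L2 G : wsum (L1 ++ L2) G = wsum L1 G + wsum L2 G.
Proof. exact: big_cat. Qed.

Lemma wsum1 w l h G : wsum [:: (w, l, h)] G = w * G l h.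
Proof. exact: big_seq1. Qed.

Lemma wsum_scale a L G : wsum (wscale a L) G = a * wsum L G.
Proof.
rewrite /wsum big_map mulr_sumr; apply: eq_bigr => q _ /=.
by rewrite mulrA.
Qed.

Lemma wsum_le L G1 G2 : wpos L ->
  (forall l h, (0 < l)%N -> G1 l h <= G2 l h) -> wsum L G1 <= wsum L G2.
Proof.
move=> /allP Lpos le12; rewrite /wsum big_seq [leRHS]big_seq.
apply: ler_sum => q /Lpos /andP[w0 l0].
exact/ler_wpM2l/le12.
Qed.

Lemma wsum_ge0 L G : wpos L -> (forall l h, 0 <= G l h) -> 0 <= wsum L G.
Proof.
move=> Lpos G0; apply: le_trans (@wsum_le L (fun _ _ => 0) G Lpos _) => //.
by rewrite /wsum big1 // => q _; rewrite mulr0.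
Qed.

Lemma wsum_exchange L (I : Type) (s : seq I) (F : I -> nat -> nat -> R) :
  wsum L (fun l h => \sum_(i <- s) F i l h) = \sum_(i <- s) wsum L (F i).
Proof.
rewrite /wsum exchange_big /=; apply: eq_bigr => q _.
by rewrite mulr_sumr.
Qed.

Lemma wsumZ L a G : wsum L (fun l h => a * G l h) = a * wsum L G.
Proof. by rewrite /wsum mulr_sumr; apply: eq_bigr => q _; rewrite mulrCA. Qed.

Lemma wpos_cat L1 L2 : wpos (L1 ++ L2) = wpos L1 && wpos L2.
Proof. exact: all_cat. Qed.

Lemma wpos_scale a L : 0 <= a -> wpos L -> wpos (wscale a L).
Proof.
move=> a0 /allP Lpos; apply/allP => _ /mapP[q /Lpos /andP[w0 l0] ->] /=.
by rewrite mulr_ge0.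
Qed.

(** * Rademacher-Menshov subdivision along general cut points *)

Section CutPoints.
Variable t : nat -> nat.
Hypothesis t_homo : {homo t : i j / (i <= j)%N}.
Hypothesis t_gt0 : forall i, (0 < i)%N -> (0 < t i)%N.

(** Beyond the leaves only left halves are recorded: an initial stretch is a disjoint union of left
    halves and at most one leaf. The factors telescope, so in [halving u l] every interval ends up
    with weight [u + 1]. *)
Fixpoint halving (u l : nat) : seq (R * nat * nat) :=
  if u is v.+1 then
    wscale (v.+2%:R / v.+1%:R) (halving v l ++ halving v (l + 2 ^ v))
    ++ [:: (v.+2%:R, t l, t (l + 2 ^ v))]
  else [:: (1, t l, t l.+1)].

Lemma halving_pos u l : (0 < l)%N -> wpos (halving u l).
Proof.
elim: u l => [|u IH] l l0 /=; first by rewrite ler01 t_gt0.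
rewrite wpos_cat wpos_scale ?divr_ge0 //=; first by rewrite ler0n t_gt0.
by rewrite wpos_cat !IH // addn_gt0 l0.
Qed.

(* The elementary step is [(A + y)^2 <= (1 + p) A^2 + (1 + 1/p) y^2] with [p = u + 1]. *)
Lemma halving_bound f u l h : (0 < l)%N -> (h <= 2 ^ u)%N ->
  isum_sqr f (t l) (t (l + h)) <= wsum (halving u l) (isum_sqr f).
Proof.
elim: u l h => [|u IH] l h l0.
  rewrite expn0 /= wsum1 mul1r; case: h => [|[|//]] _.
    by rewrite addn0 /isum_sqr {1}/isum big_geq // expr0n sqr_ge0.
  by rewrite addn1.
move=> hu; rewrite /= wsum_cat wsum_scale wsum_cat wsum1.
set p : R := u.+1%:R; have -> : u.+2%:R = p + 1 by rewrite /p -natr1.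
have p0 : 0 < p by rewrite /p.
clearbody p.
have g0 k : (0 < k)%N -> 0 <= wsum (halving u k) (isum_sqr f).
  by move=> k0; apply: wsum_ge0; [exact: halving_pos|exact: isum_sqr_ge0].
have H1 := g0 l l0.
have H2 : 0 <= wsum (halving u (l + 2 ^ u)) (isum_sqr f) by rewrite g0 // addn_gt0 l0.
have p1 : 1 <= (p + 1) / p by rewrite ler_pdivlMr // mul1r lerDl.
have [hu'|hu'] := leqP h (2 ^ u).
  apply: le_trans (IH l h l0 hu') _.
  apply: (@le_trans _ _ ((p + 1) / p * wsum (halving u l) (isum_sqr f))).
    by rewrite ler_peMl.
  rewrite mulrDr -addrA lerDl; apply: addr_ge0; apply: mulr_ge0 => //.
  - exact: le_trans p1.
  - by rewrite addr_ge0 // ltW.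
  - exact: isum_sqr_ge0.
have /IH : (h - 2 ^ u <= 2 ^ u)%N by rewrite expnS in hu; lia.
move=> /(_ (l + 2 ^ u)%N); rewrite addn_gt0 l0 => /(_ isT).
have -> : (l + 2 ^ u + (h - 2 ^ u) = l + h)%N by lia.
rewrite {1 3 6}/isum_sqr (@isum_cat f (t l) (t (l + 2 ^ u))); first last.
- by apply: t_homo; lia.
- by apply: t_homo; lia.
move: H1 H2; set y := isum _ _ _; set A := isum _ _ _.
set W1 := wsum _ _; set W2 := wsum _ _ => H1 H2 yW.
have key : (A + y) ^+ 2 <= (p + 1) / p * y ^+ 2 + (p + 1) * A ^+ 2.
  rewrite -subr_ge0.
  have -> : (p + 1) / p * y ^+ 2 + (p + 1) * A ^+ 2 - (A + y) ^+ 2 =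
            (p * A - y) ^+ 2 / p.
    by field; rewrite gt_eqF.
  by rewrite divr_ge0 ?sqr_ge0 // ltW.
apply: (le_trans key); rewrite lerD2r ler_wpM2l //; first by apply: le_trans p1.
by rewrite (le_trans yW) // lerDr.
Qed.

(** Each of the [u + 1] levels covers a point at most once, with final weight [u + 1]. In the
    induction the left half gives [p (p + 1) + (p + 1) = (p + 1) ^ 2], and the right half has
    [p + 1] to spare. *)
Lemma halving_cost b u l : (forall j, 0 <= b j) ->
  wsum (halving u l) (isum b) <= u.+1%:R ^+ 2 * isum b (t l) (t (l + 2 ^ u)).
Proof.
move=> b0; elim: u l => [|u IH] l; first by rewrite wsum1 expn0 addn1 expr1n.
rewrite /= wsum_cat wsum_scale wsum_cat wsum1.
rewrite (@isum_cat b (t l) (t (l + 2 ^ u)) (t (l + 2 ^ u.+1))); first last.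
- by apply: t_homo; rewrite leq_add2l leq_exp2l.
- by apply: t_homo; lia.
have := IH l; have := IH (l + 2 ^ u)%N.
rewrite -addnA addnn -mul2n -expnS.
have := @isum_ge0 b (t (l + 2 ^ u)) (t (l + 2 ^ u.+1)) b0.
set x := isum _ _ _; set y := isum _ _ _; set W2 := wsum _ _; set W1 := wsum _ _.
set p : R := u.+1%:R; have -> : u.+2%:R = p + 1 by rewrite /p -natr1.
have p0 : 0 < p by rewrite /p.
clearbody p.
move=> x0 H2 H1.
apply: (@le_trans _ _ ((p + 1) / p * (p ^+ 2 * y + p ^+ 2 * x) + (p + 1) * y)).
  by rewrite lerD2r ler_wpM2l ?lerD // divr_ge0 //; lra.
have -> : (p + 1) / p * (p ^+ 2 * y + p ^+ 2 * x) + (p + 1) * y =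
  (p + 1) ^+ 2 * (y + x) - (p + 1) * x by field; rewrite gt_eqF.
by rewrite gerBl mulr_ge0 //; lra.
Qed.

(** The factor 2 comes from [(A + y) ^ 2 <= 2 A ^ 2 + 2 y ^ 2], which separates the complete blocks
    before an index from the stretch inside its own block. The entry for the whole block feeds the
    summation over blocks. *)
Definition block (v : nat) : seq (R * nat * nat) :=
  (2 * v.+1%:R * v.+2%:R, t (2 ^ v), t (2 ^ v.+1)) :: wscale 2 (halving v (2 ^ v)).

Fixpoint blocks (u : nat) := if u is v.+1 then blocks v ++ block v else [::].

Lemma wsum_block v G : wsum (block v) G =
  2 * v.+1%:R * v.+2%:R * G (t (2 ^ v)) (t (2 ^ v.+1))
  + 2 * wsum (halving v (2 ^ v)) G.
Proof. by rewrite /wsum big_cons /= -wsum_scale. Qed.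

Lemma block_pos v : wpos (block v).
Proof.
rewrite /= !mulr_ge0 ?ler0n //= t_gt0 ?expn_gt0 //=.
by rewrite wpos_scale ?ler0n // halving_pos // expn_gt0.
Qed.

Lemma blocks_pos u : wpos (blocks u).
Proof. by elim: u => //= u IH; rewrite wpos_cat IH block_pos. Qed.

(* Cauchy-Schwarz with weights [1/((v+1)(v+2))], whose partial sums are [u/(u+1)]. *)
Lemma blocks_full f u :
  2 * (u.+1%:R * isum_sqr f (t 1) (t (2 ^ u))) <= u%:R * wsum (blocks u) (isum_sqr f).
Proof.
elim: u => [|u IH].
  by rewrite expn0 /isum_sqr /isum big_geq // expr0n /= !(mulr0, mul0r).
rewrite /= wsum_cat wsum_block {1}/isum_sqr.
rewrite (@isum_cat f (t 1) (t (2 ^ u)) (t (2 ^ u.+1))); first last.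
- by apply: t_homo; rewrite leq_exp2l.
- by apply: t_homo; rewrite expn_gt0.
have : 0 <= wsum (halving u (2 ^ u)) (isum_sqr f).
  by apply: wsum_ge0; [rewrite halving_pos // expn_gt0|exact: isum_sqr_ge0].
have : 0 <= wsum (blocks u) (isum_sqr f).
  by apply: wsum_ge0; [rewrite blocks_pos|exact: isum_sqr_ge0].
move: IH; rewrite /isum_sqr.
set A := isum _ _ _; set y := isum _ _ _; set W := wsum _ _; set V := wsum _ _.
rewrite -(@natr1 _ u.+1) -(@natr1 _ u); set n : R := u%:R => IH W0 V0.
have n0 : 0 <= n by rewrite /n.
clearbody n.
(* At [n = 0] division by [n] is impossible, but the induction hypothesis then forces [A = 0]. *)
have [n00|n00] := eqVneq n 0.
  have A0 : A = 0.
    by apply/eqP; rewrite -sqrf_eq0; apply/eqP; move: IH (sqr_ge0 A); rewrite n00; lra.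
  rewrite A0 n00; move: (sqr_ge0 y); lra.
have np : 0 < n by rewrite lt_def n00.
have A2 : 2 * ((n + 1) * A ^+ 2) / n <= W by rewrite ler_pdivrMr // [W * n]mulrC.
have key : (n + 2) * (A + y) ^+ 2 <=
    (n + 1) * ((n + 1) * A ^+ 2 / n + (n + 1) * (n + 2) * y ^+ 2).
  rewrite -subr_ge0.
  have -> : (n + 1) * ((n + 1) * A ^+ 2 / n + (n + 1) * (n + 2) * y ^+ 2)
      - (n + 2) * (A + y) ^+ 2 = (A - n * (n + 2) * y) ^+ 2 / n.
    by field.
  by rewrite divr_ge0 // sqr_ge0.
have : (n + 1) * (2 * ((n + 1) * A ^+ 2) / n) <= (n + 1) * W.
  by rewrite ler_wpM2l //; lra.
have : 0 <= (n + 1) * V by rewrite mulr_ge0 //; lra.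
have -> : (n + 1) * (2 * ((n + 1) * A ^+ 2) / n) = 2 * ((n + 1) * ((n + 1) * A ^+ 2 / n)).
  by field.
have -> : n + 1 + 1 = n + 2 by ring.
lra.
Qed.

(** If [i] lies in the last block, [blocks_full] controls the blocks before it and [halving_bound]
    the stretch inside; otherwise the last block only adds nonnegative terms. *)
Lemma blocks_bound f u i : (0 < i < 2 ^ u)%N ->
  isum_sqr f (t 1) (t i) <= wsum (blocks u) (isum_sqr f).
Proof.
elim: u => [|u IH] /andP[i0 iu]; first by rewrite expn0 ltnNge i0 in iu.
have V0 : 0 <= wsum (halving u (2 ^ u)) (isum_sqr f).
  by apply: wsum_ge0; [rewrite halving_pos // expn_gt0|exact: isum_sqr_ge0].
have W0 : 0 <= wsum (blocks u) (isum_sqr f).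
  by apply: wsum_ge0; [rewrite blocks_pos|exact: isum_sqr_ge0].
have D0 : 0 <= 2 * u.+1%:R * u.+2%:R * isum_sqr f (t (2 ^ u)) (t (2 ^ u.+1)).
  by apply: mulr_ge0; [rewrite !mulr_ge0|exact: isum_sqr_ge0].
rewrite /= wsum_cat wsum_block.
have [iu'|iu'] := ltnP i (2 ^ u).
  by have := IH; rewrite i0 iu' => /(_ isT); lra.
set A := isum f (t 1) (t (2 ^ u)); set y := isum f (t (2 ^ u)) (t i).
have yV : y ^+ 2 <= wsum (halving u (2 ^ u)) (isum_sqr f).
  have iu2 : (i - 2 ^ u <= 2 ^ u)%N by rewrite expnS in iu; lia.
  have u0 : (0 < 2 ^ u)%N by rewrite expn_gt0.
  by have := halving_bound f u0 iu2; rewrite subnKC.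
have AW : 2 * A ^+ 2 <= wsum (blocks u) (isum_sqr f).
  rewrite -(@ler_pM2l _ u.+1%:R) // mulrCA.
  by apply: (le_trans (blocks_full f u)); rewrite ler_wpM2r // ler_nat.
have -> : isum_sqr f (t 1) (t i) = (A + y) ^+ 2.
  by rewrite /isum_sqr -isum_cat // t_homo // expn_gt0.
have := sqr_ge0 (A - y); rewrite sqrrB sqrrD; lra.
Qed.

(** On block [v] the weights add up to at most [2 (v + 1) (v + 2) + 2 (v + 1) ^ 2], and
    [v + 2 <= 2 (v + 1)]. *)
Lemma blocks_cost b u : (forall j, 0 <= b j) ->
  wsum (blocks u) (isum b) <=
  6 * \sum_(0 <= v < u) v.+1%:R ^+ 2 * isum b (t (2 ^ v)) (t (2 ^ v.+1)).
Proof.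
move=> b0; elim: u => [|u IH]; first by rewrite big_geq // mulr0 /wsum big_nil.
rewrite big_nat_recr //= wsum_cat wsum_block [6 * _]mulrDr lerD //.
have := @halving_cost b u (2 ^ u) b0; rewrite addnn -mul2n -expnS.
have := @isum_ge0 b (t (2 ^ u)) (t (2 ^ u.+1)) b0.
move: (isum b _ _) (wsum _ _) => x W x0; rewrite -(@natr1 _ u.+1).
set n : R := u.+1%:R; have n1 : 1 <= n by rewrite /n ler1n.
clearbody n.
have : 0 <= (n - 1) * (n * x) by rewrite !mulr_ge0 //; lra.
have -> : (n - 1) * (n * x) = n ^+ 2 * x - n * x by ring.
have -> : 2 * n * (n + 1) * x = 2 * (n ^+ 2 * x) + 2 * (n * x) by ring.
lra.
Qed.

End CutPoints.

(** A point of [[2 ^ k, 2 ^ k.+1)] is covered only by [m] in the same dyadic block: at most [2 ^ k]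
    intervals, each of weight at most [1 / 2 ^ k]. *)
Lemma dyadic_mean_cost b k : (forall j, 0 <= b j) ->
  \sum_(1 <= m < 2 ^ k) m%:R^-1 * isum b (2 ^ trunc_log 2 m) m.+1 <= isum b 1 (2 ^ k).
Proof.
move=> b0; elim: k => [|k IH]; first by rewrite expn0 /isum !big_geq.
have k1 : (2 ^ k <= 2 ^ k.+1)%N by rewrite leq_exp2l.
have k0 : (0 < 2 ^ k)%N by rewrite expn_gt0.
rewrite (@big_cat_nat _ _ _ (2 ^ k)) //= (@isum_cat _ 1 (2 ^ k)) // lerD //.
apply: (@le_trans _ _ (\sum_(2 ^ k <= m < 2 ^ k.+1)
    (2 ^ k)%:R^-1 * isum b (2 ^ k) (2 ^ k.+1))).
  rewrite big_nat [leRHS]big_nat; apply: ler_sum => m /andP[km mk].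
  rewrite (@trunc_log_eq 2 k m) ?km // ler_pM ?invr_ge0 ?ler0n ?isum_ge0 //.
    by rewrite lef_pV2 ?posrE ?ltr0n ?ler_nat // (leq_trans k0).
  by rewrite (@isum_cat _ _ m.+1 (2 ^ k.+1)) ?lerDl ?isum_ge0 // leqW.
have kk : (2 ^ k.+1 - 2 ^ k = 2 ^ k)%N by rewrite expnS; lia.
rewrite sumr_const_nat kk.
by rewrite -mulrnAl -(mulr_natr (_^-1)) mulVf ?mul1r // pnatr_eq0 -lt0n.
Qed.

(** The predecessor makes [dyad 1 = 1], so that sums from cut point 1 on start at index 1. *)
Definition dyad (i : nat) : nat := 2 ^ i.-1.

Lemma dyad_homo : {homo dyad : i j / (i <= j)%N}.
Proof. by move=> i j ij; rewrite /dyad leq_exp2l //; lia. Qed.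

Lemma dyad_gt0 i : (0 < i)%N -> (0 < dyad i)%N.
Proof. by rewrite expn_gt0. Qed.

(** Block [v] of the cut points spans the indices from [2 ^ (2 ^ v - 1)] to [2 ^ (2 ^ v.+1 - 1)],
    where [v + 1] is of the order of [log log j]: this is the origin of the iterated logarithm. *)
Definition strong (u : nat) : seq (R * nat * nat) :=
  wscale 2 (blocks dyad u) ++
  [seq (2 * m%:R^-1, (2 ^ trunc_log 2 m)%N, m.+1) | m <- index_iota 1 (dyad (2 ^ u))].

Lemma strong_pos u : wpos (strong u).
Proof.
rewrite wpos_cat wpos_scale ?ler0n //=; last exact: (blocks_pos dyad_gt0).
by apply/allP => _ /mapP[m _ ->] /=; rewrite expn_gt0 mulr_ge0 // invr_ge0.
Qed.

Lemma wsum_strong u G : wsum (strong u) G = 2 * wsum (blocks dyad u) G +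
  2 * \sum_(1 <= m < dyad (2 ^ u)) m%:R^-1 * G (2 ^ trunc_log 2 m)%N m.+1.
Proof.
rewrite wsum_cat wsum_scale; congr (_ + _).
by rewrite /wsum big_map mulr_sumr; apply: eq_bigr => m _; rewrite mulrA.
Qed.

(* [s_m] is split at the largest power of 2 below [m]; on the remainder the mean is
   bounded by the sum over all [m] with weights [1/m]. *)
Lemma strong_bound f u M : (0 < M < dyad (2 ^ u))%N ->
  M%:R^-1 * \sum_(1 <= m < M.+1) isum_sqr f 1 m.+1 <= wsum (strong u) (isum_sqr f).
Proof.
move=> /andP[M0 Mu]; set W := wsum (blocks dyad u) (isum_sqr f).
have step m : (0 < m < M.+1)%N ->
    isum_sqr f 1 m.+1 <= 2 * W + 2 * isum_sqr f (2 ^ trunc_log 2 m) m.+1.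
  move=> /andP[m0 mM]; have /andP[rm mr] := trunc_log_bounds (isT : (1 < 2)%N) m0.
  rewrite {1}/isum_sqr (@isum_cat f _ (2 ^ trunc_log 2 m)) ?expn_gt0 //; last exact: leqW.
  have : isum_sqr f 1 (2 ^ trunc_log 2 m) <= W.
    (* At position [(trunc_log 2 m).+1], [dyad] is the largest power of 2 up to [m]. *)
    apply: (@blocks_bound dyad dyad_homo dyad_gt0 f u (trunc_log 2 m).+1).
    rewrite /= -(@ltn_exp2l 2) //; have : (2 ^ trunc_log 2 m < dyad (2 ^ u))%N by lia.
    by rewrite /dyad !ltn_exp2l //; lia.
  rewrite /isum_sqr; move: (isum _ _ _) (isum _ _ _) => A y AW.
  have := sqr_ge0 (A - y); rewrite sqrrB sqrrD; lra.
apply: (@le_trans _ _ (M%:R^-1 * \sum_(1 <= m < M.+1)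
    (2 * W + 2 * isum_sqr f (2 ^ trunc_log 2 m) m.+1))).
  by rewrite ler_wpM2l ?invr_ge0 // big_nat [leRHS]big_nat; exact: ler_sum.
rewrite big_split /= sumr_const_nat subn1 /= mulrDr.
rewrite -[2 * W *+ M]mulr_natl [M%:R^-1 * (M%:R * _)]mulrA.
rewrite mulVf ?pnatr_eq0 -?lt0n // mul1r wsum_strong lerD2l -mulr_sumr mulrCA.
rewrite ler_wpM2l // mulr_sumr (@big_cat_nat _ _ _ M.+1 1 (dyad (2 ^ u))) //=.
rewrite -[leLHS]addr0 lerD //; last first.
  by apply: sumr_ge0 => m _; rewrite mulr_ge0 ?invr_ge0 ?isum_sqr_ge0.
rewrite big_nat [leRHS]big_nat; apply: ler_sum => m /andP[m0 mM].
by rewrite ler_wpM2r ?isum_sqr_ge0 // lef_pV2 ?posrE ?ltr0n ?ler_nat.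
Qed.

(** [lam] stands for the iterated logarithm. The blocks contribute [54 = 6 * 3 ^ 2], the weights
    [1/m] contribute 1 because [lam >= 1], and [strong] doubles both: [110 = 2 * 54 + 2]. *)
Lemma strong_cost b (lam : nat -> R) u : (forall j, 0 <= b j) ->
  (forall j, (0 < j)%N -> 1 <= lam j) ->
  (forall v j, (dyad (2 ^ v) <= j)%N -> v.+1%:R <= 3 * lam j) ->
  wsum (strong u) (isum b) <= 110 * \sum_(1 <= j < dyad (2 ^ u)) b j * lam j ^+ 2.
Proof.
move=> b0 lam1 lamv; rewrite wsum_strong.
have dy0 v : (0 < dyad (2 ^ v))%N by rewrite dyad_gt0 // expn_gt0.
have Hb : wsum (blocks dyad u) (isum b) <=
    54 * \sum_(1 <= j < dyad (2 ^ u)) b j * lam j ^+ 2.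
  apply: (le_trans (blocks_cost dyad_homo u b0)).
  have -> : 54 = 6 * 9 :> R by ring.
  rewrite -mulrA ler_wpM2l //; elim: u => [|u IH]; first by rewrite !big_geq // mulr0.
  have uS : (dyad (2 ^ u) <= dyad (2 ^ u.+1))%N by rewrite dyad_homo // leq_exp2l.
  rewrite big_nat_recr //= (@big_cat_nat _ _ _ (dyad (2 ^ u)) 1) //= mulrDr lerD //.
  rewrite /isum !mulr_sumr big_nat [leRHS]big_nat; apply: ler_sum => j /andP[uj _].
  rewrite mulrC [leRHS]mulrCA (_ : 9 = 3 ^+ 2) -?exprMn; last by ring.
  rewrite ler_wpM2l // lerXn2r ?nnegrE ?lamv // (le_trans _ (lamv u j uj)) //.
have Hm : isum b 1 (dyad (2 ^ u)) <= \sum_(1 <= j < dyad (2 ^ u)) b j * lam j ^+ 2.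
  rewrite /isum big_nat [leRHS]big_nat; apply: ler_sum => j /andP[j0 _].
  by rewrite ler_peMr // exprn_ege1 // lam1.
have := @dyadic_mean_cost b (2 ^ u).-1 b0; rewrite -/(dyad (2 ^ u)); lra.
Qed.

End WeightedIntervals.

(** * Lower bounds for the iterated logarithm *)

Section LogLog.
Variable R : realType.

Lemma log2_ge n (x : R) : 2 ^+ n <= x -> n%:R <= log2 x.
Proof.
move=> nx; have l2 : 0 < ln (2 : R) by rewrite ln_gt0 // ltr1n.
have p2 : 0 < 2 ^+ n :> R by rewrite exprn_gt0.
rewrite /log2 ler_pdivlMr // mulr_natl -lnXn // ler_ln ?posrE //.
exact: lt_le_trans nx.
Qed.

Lemma llw_ge n j : (2 ^ (2 ^ n) <= j + 3)%N -> n%:R <= llw j :> R.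
Proof.
move=> nj; apply: log2_ge; rewrite -natrX; apply: log2_ge.
by rewrite -natrX -natrD ler_nat.
Qed.

Lemma llw_ge1 j : (0 < j)%N -> 1 <= llw j :> R.
Proof. by move=> j0; apply: (@llw_ge 1); lia. Qed.

(** For [v >= 1] the exponent [2 ^ v - 1] is at least [2 ^ (v - 1)], so [llw j >= v - 1]; the
    missing 2 comes from [llw j >= 1], used twice. *)
Lemma llw_dyad v j : (dyad (2 ^ v) <= j)%N -> v.+1%:R <= 3 * llw j :> R.
Proof.
rewrite /dyad; case: v => [|v] vj; first by have := llw_ge1 vj; lra.
have := @llw_ge1 j (leq_trans _ vj); rewrite expn_gt0 => /(_ isT).
have : v%:R <= llw j :> R.
  apply: llw_ge; apply: leq_trans (leq_addr _ _); apply: leq_trans vj.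
  by rewrite leq_exp2l // expnS; have := expn_gt0 2 v; lia.
rewrite -!natr1; lra.
Qed.

End LogLog.

(** * Double sums *)

Section Rectangles.
Variable R : realType.
Implicit Types F a b : nat -> nat -> R.

Definition rsum F (m n : nat) : R := \sum_(1 <= j < m.+1) \sum_(1 <= k < n.+1) F j k.

Lemma isum_exchange F l h l' h' :
  isum (fun k => isum (F^~ k) l h) l' h' = isum (fun j => isum (F j) l' h') l h.
Proof. exact: exchange_big. Qed.

Definition strong_prod (u : nat) (G : nat -> nat -> nat -> nat -> R) : R :=
  wsum (strong R u) (fun l' h' => wsum (strong R u) (fun l h => G l h l' h')).

Definition rect_sqr F l h l' h' : R := isum_sqr (fun j => isum (F j) l' h') l h.

(** The one-dimensional bound is applied in [n] for each fixed [m], to the column sums over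
    [j <= m], and then in [m] for each interval [[l', h')] of the second index. *)
Lemma strong_prod_bound F u M N : (0 < M < dyad (2 ^ u))%N -> (0 < N < dyad (2 ^ u))%N ->
  (M%:R * N%:R)^-1 * \sum_(1 <= m < M.+1) \sum_(1 <= n < N.+1) rsum F m n ^+ 2
  <= strong_prod u (rect_sqr F).
Proof.
move=> Mu Nu; rewrite invfM -mulrA mulr_sumr.
apply: (@le_trans _ _ (M%:R^-1 * \sum_(1 <= m < M.+1)
    wsum (strong R u) (isum_sqr (fun k => isum (F^~ k) 1 m.+1)))).
  rewrite ler_wpM2l ?invr_ge0 //; apply: ler_sum => m _.
  apply: le_trans (strong_bound _ Nu); rewrite ler_wpM2l ?invr_ge0 //.
  by apply: ler_sum => n _; rewrite /isum_sqr isum_exchange.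
rewrite -wsum_exchange -wsumZ; apply: wsum_le => [|l' h' _]; first exact: strong_pos.
under eq_bigr do rewrite /isum_sqr isum_exchange.
exact: strong_bound.
Qed.

(** [strong_cost] is used once per variable, at a cost of 110 each: first in [j], for [b] summed
    over [[l', h')], then in [k] for each [j]. *)
Lemma strong_prod_cost b u : (forall j k, 0 <= b j k) ->
  strong_prod u (fun l h l' h' => isum (fun j => isum (b j) l' h') l h) <=
  110 ^+ 2 * \sum_(1 <= j < dyad (2 ^ u)) \sum_(1 <= k < dyad (2 ^ u))
    b j k * llw j ^+ 2 * llw k ^+ 2.
Proof.
move=> b0; apply: (@le_trans _ _ (wsum (strong R u) (fun l' h' =>
    110 * \sum_(1 <= j < dyad (2 ^ u)) llw j ^+ 2 * isum (b j) l' h'))).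
  apply: wsum_le => [|l' h' _]; first exact: strong_pos.
  under eq_bigr do rewrite mulrC.
  apply: strong_cost; [|exact: llw_ge1|exact: llw_dyad].
  by move=> j; apply: isum_ge0.
rewrite wsumZ wsum_exchange expr2 -mulrA ler_wpM2l // mulr_sumr.
apply: ler_sum => j _; rewrite wsumZ.
apply: (@le_trans _ _ (llw j ^+ 2 * (110 * \sum_(1 <= k < dyad (2 ^ u)) b j k * llw k ^+ 2))).
  rewrite ler_wpM2l ?sqr_ge0 //.
  by apply: strong_cost; [|exact: llw_ge1|exact: llw_dyad].
rewrite mulrCA ler_wpM2l // mulr_sumr le_eqVlt; apply/orP; left; apply/eqP.
by apply: eq_bigr => k _; ring.
Qed.

(** * Truncation to squares and tails *)

Lemma rsumD F1 F2 m n :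
  rsum (fun j k => F1 j k + F2 j k) m n = rsum F1 m n + rsum F2 m n.
Proof. by rewrite -big_split; apply: eq_bigr => j _; rewrite big_split. Qed.

Lemma eq_rsum F1 F2 m n : F1 =2 F2 -> rsum F1 m n = rsum F2 m n.
Proof. by move=> E; apply: eq_bigr => j _; apply: eq_bigr => k _. Qed.

Lemma sum_trunc (f : nat -> R) K m :
  \sum_(1 <= j < m.+1) (if (j <= K)%N then f j else 0) =
  \sum_(1 <= j < (minn m K).+1) f j.
Proof.
rewrite -big_mkcond /= [RHS](@big_nat_widen _ _ _ _ _ m.+1) ?ltnS ?geq_minl //.
by rewrite big_nat_cond [RHS]big_nat_cond; apply: eq_bigl => j; lia.
Qed.

Lemma rsum_trunc F K m n :
  rsum (fun j k => if (j <= K)%N && (k <= K)%N then F j k else 0) m n =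
  rsum F (minn m K) (minn n K).
Proof.
rewrite /rsum -sum_trunc; apply: eq_bigr => j _.
case: (j <= K)%N => /=; last exact: big1.
exact: sum_trunc.
Qed.

Lemma rsum_tail F K m n :
  rsum (fun j k => if (j <= K)%N && (k <= K)%N then 0 else F j k) m n =
  rsum F m n - rsum F (minn m K) (minn n K).
Proof.
rewrite -rsum_trunc; apply/eqP; rewrite eq_sym subr_eq -rsumD; apply/eqP.
by apply: eq_rsum => j k; case: ifP => _; rewrite ?addr0 ?add0r.
Qed.

Lemma rsum_le F m n m' n' : (forall j k, 0 <= F j k) -> (m <= m')%N -> (n <= n')%N ->
  rsum F m n <= rsum F m' n'.
Proof.
move=> F0 mm nn.
have sub f p q : (forall j, 0 <= f j) -> (p <= q)%N ->
    \sum_(1 <= j < p.+1) f j <= \sum_(1 <= j < q.+1) f j :> R.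
  by move=> f0 pq; rewrite (@big_cat_nat _ _ _ p.+1 1 q.+1) //= lerDl sumr_ge0.
apply: (@le_trans _ _ (rsum F m n')); last by apply: sub => // j; apply: sumr_ge0.
by apply: ler_sum => j _; apply: sub.
Qed.

(** Square partial sums increase to their supremum, and [K0] is a size at which they are within [e]
    of it. Any [m] by [n] range lies in a square of side [p >= K], whose part outside the [K] square
    is at most the remaining gap. *)
Lemma rsum_tail_small F B : (forall j k, 0 <= F j k) -> (forall m n, rsum F m n <= B) ->
  forall e : R, 0 < e -> exists K0, forall K, (K0 <= K)%N -> forall m n,
    rsum (fun j k => if (j <= K)%N && (k <= K)%N then 0 else F j k) m n <= e.
Proof.
move=> F0 FB e e0; pose A := range (fun p => rsum F p p).
have supA : has_sup A.
  by split; [exists (rsum F 0 0), 0%N|exists B => _ [p _ <-]].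
have [_ [K0 _ <-] K0A] := sup_adherent e0 supA.
exists K0 => K K0K m n; pose p := maxn K (maxn m n).
have Kp : (K <= p)%N by rewrite leq_maxl.
apply: (@le_trans _ _ (rsum (fun j k => if (j <= K)%N && (k <= K)%N then 0 else F j k) p p)).
  by apply: rsum_le; [move=> j k; case: ifP|rewrite /p; lia|rewrite /p; lia].
rewrite rsum_tail (minn_idPr Kp).
have : rsum F p p <= sup A by apply: ub_le_sup; [case: supA|exists p].
have := rsum_le F0 K0K K0K; lra.
Qed.

(* Only the [K (M + N)] terms with [m < K] or [n < K] contribute. *)
Lemma mean_eventually_small (D : nat -> nat -> R) (Q : R) (K : nat) : 0 <= Q ->
  (forall m n, D m n <= Q) -> (forall m n, (K <= m)%N -> (K <= n)%N -> D m n = 0) ->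
  forall e : R, 0 < e -> exists N0 : nat, forall M N, (N0 <= M)%N -> (N0 <= N)%N ->
    (M%:R * N%:R)^-1 * \sum_(1 <= m < M.+1) \sum_(1 <= n < N.+1) D m n <= e.
Proof.
move=> Q0 DQ D0 e e0.
have few L : \sum_(1 <= m < L.+1) (m < K)%N%:R <= K%:R :> R.
  rewrite -natr_sum ler_nat; apply: (@leq_trans (minn L K)); last exact: geq_minr.
  elim: L => [|L IH]; first by rewrite big_geq.
  by rewrite big_nat_recr //=; move: IH; case: ltnP; lia.
have bound M N :
    \sum_(1 <= m < M.+1) \sum_(1 <= n < N.+1) D m n <= Q * (K%:R * (N%:R + M%:R)).
  apply: (@le_trans _ _ (\sum_(1 <= m < M.+1) \sum_(1 <= n < N.+1)
     Q * ((m < K)%N%:R + (n < K)%N%:R))).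
    apply: ler_sum => m _; apply: ler_sum => n _.
    have [mK|Km] := ltnP m K.
      by rewrite (le_trans (DQ m n)) // ler_peMr // lerDl ler0n.
    have [nK|Kn] := ltnP n K; first by rewrite add0r mulr1.
    by rewrite D0 // mulr_ge0.
  have E m : \sum_(1 <= n < N.+1) Q * ((m < K)%N%:R + (n < K)%N%:R) =
      Q * ((m < K)%N%:R * N%:R + \sum_(1 <= n < N.+1) (n < K)%N%:R).
    by rewrite -mulr_sumr big_split /= sumr_const_nat subn1 /= [_ * N%:R]mulr_natr.
  rewrite (eq_bigr _ (fun m _ => E m)) -mulr_sumr big_split /= sumr_const_nat subn1 /=.
  by rewrite -mulr_suml -[_ *+ M]mulr_natr [K%:R * _]mulrDr ler_wpM2l // lerD // ler_wpM2r.
(* Beyond this threshold both [Q K / M] and [Q K / N] are at most [e / 2]. *)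
have x0 : 0 <= 2 * Q * K%:R / e by rewrite divr_ge0 ?mulr_ge0 ?ler0n // ltW.
have := archi_boundP x0; set N0 := Num.bound _ => /ltW xN0.
have big M : (N0.+1 <= M)%N -> 2 * (Q * K%:R) <= e * M%:R.
  move=> N0M; rewrite mulrA -ler_pdivrMl // mulrC (le_trans xN0) // ler_nat; lia.
exists N0.+1 => M N NM NN.
have M0 : 0 < M%:R :> R by rewrite ltr0n; lia.
have N'0 : 0 < N%:R :> R by rewrite ltr0n; lia.
rewrite ler_pdivrMl ?mulr_gt0 //; apply: (le_trans (bound M N)).
have HM : 2 * (Q * K%:R) * N%:R <= e * M%:R * N%:R by rewrite ler_wpM2r ?big // ltW.
have HN : 2 * (Q * K%:R) * M%:R <= e * N%:R * M%:R by rewrite ler_wpM2r ?big // ltW.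
have -> : Q * (K%:R * (N%:R + M%:R)) = Q * K%:R * N%:R + Q * K%:R * M%:R by ring.
have E : e * N%:R * M%:R = e * M%:R * N%:R by ring.
have -> : M%:R * N%:R * e = e * M%:R * N%:R by ring.
lra.
Qed.

End Rectangles.

(** * Integration *)

Section Integrals.
Context (d : measure_display) (T : measurableType d) (R : realType).
Variable mu : {measure set T -> \bar R}.
Implicit Types (f : T -> R) (a : R).

Definition integrates f a := mu.-integrable setT (fun x => (f x)%:E) /\
  (\int[mu]_x (f x)%:E = a%:E)%E.

Lemma integrates_ext f g a : f =1 g -> integrates f a -> integrates g a.
Proof. by move=> /funext ->. Qed.

Lemma integratesZ k f a : integrates f a -> integrates (fun x => k * f x) (k * a).
Proof.
move=> [fi fa]; split; first exact: (integrableZl measurableT k fi).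
by under eq_integral do rewrite EFinM; rewrite integralZl // fa.
Qed.

Lemma integrates_sum (I : eqType) (s : seq I) (f : I -> T -> R) (a : I -> R) :
  (forall i, i \in s -> integrates (f i) (a i)) ->
  integrates (fun x => \sum_(i <- s) f i x) (\sum_(i <- s) a i).
Proof.
elim: s => [|i s IH] fa.
  rewrite big_nil; split; first by under eq_fun do rewrite big_nil; exact: integrable0.
  by under eq_integral do rewrite big_nil; rewrite integral0.
have [fi fiE] := fa i (mem_head i s).
have [fs fsE] := IH (fun k ks => fa k (mem_behead (s := i :: s) ks)).
split; first by under eq_fun do rewrite big_cons EFinD; exact: integrableD.
by under eq_integral do rewrite big_cons EFinD; rewrite integralD // fiE fsE big_cons.
Qed.

Lemma integrates_wsum L (G : T -> nat -> nat -> R) (a : nat -> nat -> R) : wpos L ->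
  (forall l h, (0 < l)%N -> integrates (fun x => G x l h) (a l h)) ->
  integrates (fun x => wsum L (G x)) (wsum L a).
Proof.
move=> /allP Lpos Ga; apply: integrates_sum => q /Lpos /andP[_ l0].
exact/integratesZ/Ga.
Qed.

(** The square is expanded into a double sum and orthonormality leaves the diagonal; [uniq] makes
    each index meet itself once. *)
Lemma integrates_sqr (I : eqType) (s : seq I) (c : I -> R) (phi : I -> T -> R) : uniq s ->
  (forall i k, i \in s -> k \in s ->
     integrates (fun x => phi i x * phi k x) (i == k)%:R) ->
  integrates (fun x => (\sum_(i <- s) c i * phi i x) ^+ 2) (\sum_(i <- s) c i ^+ 2).
Proof.
move=> s_uniq ortho.
have -> : \sum_(i <- s) c i ^+ 2 = \sum_(i <- s) \sum_(k <- s) c i * c k * (i == k)%:R.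
  rewrite big_seq [RHS]big_seq; apply: eq_bigr => i si.
  rewrite (bigD1_seq i) //= eqxx mulr1 big1 ?addr0 // => k ki.
  by rewrite eq_sym (negbTE ki) mulr0.
apply: (@integrates_ext (fun x => \sum_(i <- s) \sum_(k <- s)
    c i * c k * (phi i x * phi k x))).
  move=> x; rewrite expr2 mulr_suml; apply: eq_bigr => i _.
  by rewrite mulr_sumr; apply: eq_bigr => k _; rewrite mulrACA.
apply: integrates_sum => i si; apply: integrates_sum => k sk.
exact/integratesZ/ortho.
Qed.

Lemma measurable_ge f (e : R) : measurable_fun setT f ->
  measurable [set x | e <= f x]%classic.
Proof.
move=> /measurable_EFinP mf.
have -> : [set x | e <= f x]%classic = (setT `&` [set x | e%:E <= (f x)%:E]%E)%classic.
  by rewrite setTI; apply/seteqP; split => x /=; rewrite lee_fin.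
exact: emeasurable_fun_c_infty.
Qed.

Lemma markov_le f a (e : R) : measurable_fun setT f -> (forall x, 0 <= f x) -> 0 < e ->
  (\int[mu]_x (f x)%:E <= a%:E)%E ->
  (mu [set x | (e <= f x)%R]%classic <= (a / e)%:E)%E.
Proof.
move=> /measurable_EFinP mf f0 e0 fa.
have := @le_integral_comp_abse _ _ _ mu setT measurableT _ e id (@measurable_id _ _ _)
  (fun r h => h) (fun _ _ _ _ h => h) mf e0.
under [in leRHS]eq_integral do rewrite gee0_abs ?lee_fin ?f0 //.
move=> /le_trans/(_ fa); rewrite setTI EFinM muleC -lee_pdivlMr //.
congr (_ <= _)%E; congr (mu _).
by apply/seteqP; split => x /=; rewrite lee_fin ger0_norm.
Qed.

(** Intersecting covers of measure at most [1/(n+1)] gives a measurable null set around [A], which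
    itself may be non-measurable. *)
Lemma negligible_small (A : set T) :
  (forall e : R, 0 < e -> exists B, [/\ measurable B, (A `<=` B)%classic & (mu B <= e%:E)%E]) ->
  mu.-negligible A.
Proof.
move=> small.
have /choice[B HB] : forall n : nat, exists B,
    [/\ measurable B, (A `<=` B)%classic & (mu B <= (n.+1%:R^-1)%:E)%E].
  by move=> n; apply: small; rewrite invr_gt0.
have mB : measurable (\bigcap_n B n)%classic.
  by apply: bigcapT_measurable => n; case: (HB n).
exists (\bigcap_n B n)%classic; split => //.
  apply/eqP; rewrite eq_le measure_ge0 andbT.
  apply/lee_addgt0Pr => e e0; rewrite add0e.
  have eV0 : 0 <= e^-1 by rewrite invr_ge0 ltW.
  have /ltW eN := archi_boundP eV0.
  have [mBn _ Bn] := HB (Num.bound e^-1).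
  apply: (@le_trans _ _ (mu (B (Num.bound e^-1)))).
    by apply: le_measure; rewrite ?inE // => x; exact.
  rewrite (le_trans Bn) // lee_fin invf_ple ?posrE // (le_trans eN) //.
  by rewrite ler_nat.
by move=> x Ax n _; case: (HB n) => _ + _; exact.
Qed.
End Integrals.

(** * A weak-type maximal inequality for strong means *)

Section WeakType.
Context (d : measure_display) (T : measurableType d) (R : realType).
Variable mu : {measure set T -> \bar R}.

(** The points eventually in all [E v] form the increasing union of the tail intersections [F u].
    Each [F u] lies in [E u], so continuity from below preserves the bound [a]. *)
Lemma limsup_measure_le (E : nat -> set T) (a : R) :
  (forall u, measurable (E u)) -> (forall u, (mu (E u) <= a%:E)%E) ->
  exists A, [/\ measurable A, (mu A <= a%:E)%E &
    forall x, (exists u, forall v, (u <= v)%N -> E v x) -> A x].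
Proof.
move=> mE Ea; pose F u := (\bigcap_(v in [set v | (u <= v)%N]) E v)%classic.
have mF u : measurable (F u) by apply: bigcap_measurable => //; exists u => /=.
have mA : measurable (\bigcup_u F u)%classic by exact: bigcupT_measurable.
exists (\bigcup_u F u)%classic; split => //.
  have F_homo : {homo F : n m / (n <= m)%N >-> (n <= m)%O}.
    move=> n m nm; rewrite subsetEset => x Fx v /= mv.
    by apply: Fx => /=; exact: leq_trans mv.
  have cvF := @nondecreasing_cvg_mu _ _ _ mu _ mF mA F_homo.
  rewrite -(cvg_lim (@ereal_hausdorff R) cvF); apply: lime_le.
    by apply/cvg_ex; exists (mu (\bigcup_u F u)%classic).
  near=> u; apply: le_trans (Ea u) => /=; apply: le_measure; rewrite ?inE //.
  by move=> x; apply => /=.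
by move=> x [u Eu]; exists u => // v /= uv; exact: Eu.
Unshelve. all: by end_near.
Qed.

(** [G u] dominates all means in its range, and its integral is at most [110 ^ 2 * B] for every [u].
    A mean above [e] puts [x] in the set [e <= G u] for all large [u], and Markov's bound survives
    in the limit. *)
Lemma strong_weak_type (F : T -> nat -> nat -> R) (b : nat -> nat -> R) (B e : R) :
  (forall l h l' h', (0 < l)%N -> (0 < l')%N ->
     integrates mu (fun x => rect_sqr (F x) l h l' h')
       (isum (fun j => isum (b j) l' h') l h)) ->
  (forall j k, 0 <= b j k) ->
  (forall m n, rsum (fun j k => b j k * llw j ^+ 2 * llw k ^+ 2) m n <= B) ->
  0 < e ->
  exists A, [/\ measurable A, (mu A <= (110 ^+ 2 * B / e)%:E)%E &
    forall x, ~ A x -> forall M N, (0 < M)%N -> (0 < N)%N ->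
      (M%:R * N%:R)^-1 * \sum_(1 <= m < M.+1) \sum_(1 <= n < N.+1) rsum (F x) m n ^+ 2
      <= e].
Proof.
move=> Fb b0 bB e0; pose G u x := strong_prod u (rect_sqr (F x)).
have G0 u x : 0 <= G u x.
  apply: wsum_ge0 => [|l' h']; first exact: strong_pos.
  by apply: wsum_ge0 => [|l h]; [exact: strong_pos|exact: isum_sqr_ge0].
have Gint u : integrates mu (G u)
    (strong_prod u (fun l h l' h' => isum (fun j => isum (b j) l' h') l h)).
  apply: integrates_wsum => [|l' h' l'0]; first exact: strong_pos.
  by apply: integrates_wsum => [|l h l0]; [exact: strong_pos|exact: Fb].
have mG u : measurable_fun setT (G u).
  by case: (Gint u) => /measurable_int /measurable_EFinP.
have [|u|A [mA muA HA]] := @limsup_measure_le (fun u => [set x | e <= G u x]%classic)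
    (110 ^+ 2 * B / e).
- by move=> u; exact: measurable_ge.
- apply: markov_le => //; case: (Gint u) => _ ->; rewrite lee_fin.
  apply: (le_trans (strong_prod_cost _ b0)); rewrite ler_wpM2l //.
  by rewrite -(@prednK (dyad (2 ^ u))) ?dyad_gt0 ?expn_gt0 //; exact: bB.
exists A; split => // x nAx M N M0 N0; rewrite leNgt; apply/negP => eMN; apply: nAx.
(* For [u >= M + N] both [M] and [N] are in range, as [u <= 2 ^ u - 1 < 2 ^ (2 ^ u - 1)]. *)
apply: HA; exists (M + N)%N => u MNu /=; apply: (le_trans (ltW eMN)).
have ltu : (M + N < dyad (2 ^ u))%N.
  have uu : (u <= (2 ^ u).-1)%N by have := ltn_expl u (isT : (1 < 2)%N); lia.
  by apply: (leq_ltn_trans (leq_trans MNu uu)); exact: ltn_expl.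
by apply: strong_prod_bound; lia.
Qed.

End WeakType.

(** * Orthonormality over rectangles of indices *)

Section Orthonormal.
Context (d : measure_display) (T : measurableType d) (R : realType).
Variable mu : {measure set T -> \bar R}.
Variable psi : nat -> nat -> T -> R.
Hypothesis psi_meas : forall j k, (1 <= j)%N -> (1 <= k)%N -> measurable_fun setT (psi j k).
Hypothesis psi_L2 : forall j k, (1 <= j)%N -> (1 <= k)%N ->
  mu.-integrable setT (fun x => ((psi j k x) ^+ 2)%:E).
Hypothesis psi_ortho : forall j k j' k', (1 <= j)%N -> (1 <= k)%N ->
  (1 <= j')%N -> (1 <= k')%N ->
  (\int[mu]_x ((psi j k x * psi j' k' x)%:E) =
    (if (j == j') && (k == k') then 1 else 0)%:E)%E.

Lemma integrates_psiM j k j' k' : (1 <= j)%N -> (1 <= k)%N ->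
  (1 <= j')%N -> (1 <= k')%N ->
  integrates mu (fun x => psi j k x * psi j' k' x) ((j, k) == (j', k'))%:R.
Proof.
move=> j0 k0 j'0 k'0; split; last first.
  by rewrite psi_ortho // xpair_eqE; case: ifP.
(* The product is integrable by [|a b| <= a ^ 2 + b ^ 2]. *)
apply: (@le_integrable _ _ _ _ _ measurableT _
    (fun x => ((psi j k x ^+ 2)%:E + (psi j' k' x ^+ 2)%:E)%E)).
- by apply/measurable_EFinP; apply: measurable_funM; exact: psi_meas.
- move=> x _; rewrite -EFinD !abse_EFin lee_fin normrM.
  rewrite [leRHS]ger0_norm ?addr_ge0 ?sqr_ge0 //; have := sqr_ge0 (`|psi j k x| - `|psi j' k' x|).
  rewrite sqrrB !real_normK ?num_real //.
  have := mulr_ge0 (normr_ge0 (psi j k x)) (normr_ge0 (psi j' k' x)); lra.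
- by apply: integrableD => //; exact: psi_L2.
Qed.

(** Listing the rectangle as pairs makes the system singly indexed, so that [integrates_sqr]
    applies. Positive [l] and [l'] keep all pairs in the orthonormal range. *)
Lemma integrates_rect_sqr (c : nat -> nat -> R) l h l' h' : (0 < l)%N -> (0 < l')%N ->
  integrates mu (fun x => rect_sqr (fun j k => c j k * psi j k x) l h l' h')
    (isum (fun j => isum (fun k => c j k ^+ 2) l' h') l h).
Proof.
move=> l0 l'0.
pose s := [seq (j, k) | j <- index_iota l h, k <- index_iota l' h'].
have sumE (f : nat -> nat -> R) :
    isum (fun j => isum (f j) l' h') l h = \sum_(i <- s) f i.1 i.2.
  by rewrite big_allpairs_dep.
have spos i : i \in s -> (0 < i.1)%N && (0 < i.2)%N.
  case/allpairsP => -[j k] /= [+ + ->] /=; rewrite !mem_index_iota.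
  by move=> /andP[lj _] /andP[lk _]; rewrite (leq_trans l0) // (leq_trans l'0).
rewrite sumE; apply: (@integrates_ext _ _ _ _
    (fun x => (\sum_(i <- s) c i.1 i.2 * psi i.1 i.2 x) ^+ 2)).
  by move=> x; rewrite /rect_sqr /isum_sqr sumE.
apply: integrates_sqr.
  by rewrite allpairs_uniq ?iota_uniq // => -[j k] [j' k'] _ _.
move=> [j k] [j' k'] /spos /andP[j0 k0] /spos /andP[j'0 k'0].
exact: integrates_psiM.
Qed.

Lemma measurable_psum (c : nat -> nat -> R) m n : measurable_fun setT (psum c psi m n).
Proof.
(* The shift by one is made because [measurable_sum] asks for measurability at every index, whereas
   [psi j k] is known to be measurable for [j, k >= 1]. *)
rewrite (_ : psum c psi m n = fun x => \sum_(0 <= j < m) \sum_(0 <= k < n)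
    c j.+1 k.+1 * psi j.+1 k.+1 x); last first.
  apply/funext => x; rewrite /psum big_add1; apply: eq_bigr => j _.
  by rewrite big_add1.
apply: measurable_sum => j; apply: measurable_sum => k.
by apply: measurable_funM; [exact: measurable_cst|exact: psi_meas].
Qed.

End Orthonormal.

(* With [S] the square partial sum over [j, k <= K], each [s_mn - g] is the sum of the
   partial sum of the tail, of a difference that vanishes for [m, n >= K], and of [S - g]. *)
Lemma cesaro_mean_eventually_le (T : Type) (R : realType) (c : nat -> nat -> R)
    (psi : nat -> nat -> T -> R) (g : T -> R) (K : nat) (e : R) (x : T) : 0 < e ->
  (forall M N, (0 < M)%N -> (0 < N)%N ->
    (M%:R * N%:R)^-1 * \sum_(1 <= m < M.+1) \sum_(1 <= n < N.+1)
      rsum (fun j k => if (j <= K)%N && (k <= K)%N then 0 else c j k * psi j k x) m n ^+ 2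
    <= e) ->
  `|psum c psi K K x - g x| ^+ 2 <= e ->
  exists N0 : nat, forall M N, (N0 <= M)%N -> (N0 <= N)%N ->
    `|cesaro_mean c psi g M N x| <= 9 * e.
Proof.
move=> e0 tail_le diff_le; pose F j k := c j k * psi j k x.
pose D m n := (rsum F (minn m K) (minn n K) - rsum F K K) ^+ 2.
(* [D] depends only on [minn m K] and [minn n K], hence takes finitely many values; their sum is a
   uniform bound. *)
pose Q := \sum_(p < K.+1) \sum_(q < K.+1) (rsum F p q - rsum F K K) ^+ 2.
have Q0 : 0 <= Q by apply: sumr_ge0 => p _; apply: sumr_ge0 => q _; exact: sqr_ge0.
have DQ m n : D m n <= Q.
  have mK : (minn m K < K.+1)%N by rewrite ltnS geq_minr.
  have nK : (minn n K < K.+1)%N by rewrite ltnS geq_minr.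
  rewrite /Q (bigD1 (Ordinal mK)) //= (bigD1 (Ordinal nK)) //= -addrA lerDl.
  rewrite addr_ge0 // sumr_ge0 // => p _; first exact: sqr_ge0.
  by apply: sumr_ge0 => q _; exact: sqr_ge0.
have D0 m n : (K <= m)%N -> (K <= n)%N -> D m n = 0.
  by move=> Km Kn; rewrite /D (minn_idPr Km) (minn_idPr Kn) subrr expr0n.
have [N0 HN0] := mean_eventually_small Q0 DQ D0 e0.
exists N0.+1 => M N NM NN.
have M0 : (0 < M)%N by lia.
have N'0 : (0 < N)%N by lia.
have mean0 : 0 <= (M%:R * N%:R)^-1 :> R by rewrite invr_ge0 mulr_ge0.
rewrite ger0_norm; last first.
  by rewrite mulr_ge0 // sumr_ge0 // => m _; rewrite sumr_ge0 // => n _; exact: exprn_ge0.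
pose h := rsum F K K - g x.
have h_le : h ^+ 2 <= e by rewrite -[h ^+ 2]real_normK ?num_real.
pose U m n := rsum (fun j k => if (j <= K)%N && (k <= K)%N then 0 else F j k) m n.
(* This is [(a + b + h) ^ 2 <= 3 (a ^ 2 + b ^ 2 + h ^ 2)]; three means of size [e] then give the
   constant 9. *)
have pointwise m n : `|psum c psi m n x - g x| ^+ 2 <= 3 * U m n ^+ 2 + (3 * D m n + 3 * e).
  rewrite real_normK ?num_real // /U rsum_tail /D.
  have -> : psum c psi m n x - g x = (rsum F m n - rsum F (minn m K) (minn n K))
      + (rsum F (minn m K) (minn n K) - rsum F K K) + h.
    by rewrite /h -[psum c psi m n x]/(rsum F m n); ring.
  move: (rsum F m n - _) (rsum F (minn m K) (minn n K) - _) => a b; clearbody h.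
  have := sqr_ge0 (a - b); have := sqr_ge0 (b - h); have := sqr_ge0 (a - h).
  nra.
apply: (@le_trans _ _ ((M%:R * N%:R)^-1 * \sum_(1 <= m < M.+1) \sum_(1 <= n < N.+1)
    (3 * U m n ^+ 2 + (3 * D m n + 3 * e)))).
  by rewrite ler_wpM2l //; apply: ler_sum => m _; apply: ler_sum => n _.
have -> : \sum_(1 <= m < M.+1) \sum_(1 <= n < N.+1) (3 * U m n ^+ 2 + (3 * D m n + 3 * e)) =
    3 * (\sum_(1 <= m < M.+1) \sum_(1 <= n < N.+1) U m n ^+ 2) +
    3 * (\sum_(1 <= m < M.+1) \sum_(1 <= n < N.+1) D m n) + 3 * e * (M%:R * N%:R).
  rewrite -[LHS]/(rsum _ M N) rsumD rsumD -addrA; congr (_ + (_ + _)).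
  - by rewrite mulr_sumr; apply: eq_bigr => m _; rewrite mulr_sumr.
  - by rewrite mulr_sumr; apply: eq_bigr => m _; rewrite mulr_sumr.
  - rewrite /rsum !sumr_const_nat !subn1 /= -mulrnA -[_ *+ _]mulr_natr natrM.
    by rewrite [N%:R * _]mulrC.
have := tail_le M N M0 N'0; rewrite -/U.
have := HN0 M N (ltnW NM) (ltnW NN).
rewrite !mulrDr ![_^-1 * (3 * _)]mulrCA [_^-1 * (3 * e * _)]mulrCA mulVf ?mulr1; last first.
  by rewrite mulf_neq0 // pnatr_eq0 -lt0n.
lra.
Qed.

(** * Almost everywhere convergence *)

Theorem theorem2 (d : measure_display) (T : measurableType d) (R : realType)
  (mu : {finite_measure set T -> \bar R})
  (psi : nat -> nat -> T -> R) (c : nat -> nat -> R) (g : T -> R)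
  (psi_meas : forall j k, (1 <= j)%N -> (1 <= k)%N -> measurable_fun setT (psi j k))
  (psi_L2 : forall j k, (1 <= j)%N -> (1 <= k)%N ->
     mu.-integrable setT (fun x => ((psi j k x) ^+ 2)%:E))
  (psi_ortho : forall j k j' k', (1 <= j)%N -> (1 <= k)%N ->
     (1 <= j')%N -> (1 <= k')%N ->
     (\int[mu]_x ((psi j k x * psi j' k' x)%:E) =
       (if (j == j') && (k == k') then 1 else 0)%:E)%E)
  (c_sum : exists B : R, forall m n : nat,
     \sum_(1 <= j < m.+1) \sum_(1 <= k < n.+1)
        c j k ^+ 2 * llw j ^+ 2 * llw k ^+ 2 <= B)
  (g_meas : measurable_fun setT g)
  (g_L2 : mu.-integrable setT (fun x => ((g x) ^+ 2)%:E))
  (g_sum : forall e : R, 0 < e -> exists N0 : nat, forall m n : nat,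
     (N0 <= m)%N -> (N0 <= n)%N ->
     (\int[mu]_x ((`|psum c psi m n x - g x| ^+ 2)%:E) <= e%:E)%E) :
  {ae mu, forall x, forall e : R, 0 < e -> exists N0 : nat, forall M N : nat,
     (N0 <= M)%N -> (N0 <= N)%N -> `|cesaro_mean c psi g M N x| <= e}.
Proof.
pose good (e : R) x := exists N0 : nat, forall M N : nat,
  (N0 <= M)%N -> (N0 <= N)%N -> `|cesaro_mean c psi g M N x| <= e.
have bad_negl (e : R) : 0 < e -> mu.-negligible [set x | ~ good (9 * e) x]%classic.
  move=> e0; apply: negligible_small => dl dl0.
  have [B cB] := c_sum.
  pose w j k := c j k ^+ 2 * llw j ^+ 2 * llw k ^+ 2.
  have w0 j k : 0 <= w j k by rewrite /w -!exprMn sqr_ge0.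
  (* With this [eta] the weak-type bound [110 ^ 2 * eta / e] equals [dl / 2]; Markov's inequality
     for the squared distance from [psum c psi K K] to [g] supplies the other half. *)
  pose eta := e * (dl / 2) / 110 ^+ 2.
  have eta0 : 0 < eta by rewrite divr_gt0 ?exprn_gt0 // mulr_gt0 // divr_gt0.
  have [K0 HK0] := rsum_tail_small w0 cB eta0.
  have [N0 HN0] := g_sum (e * (dl / 2)) (mulr_gt0 e0 (divr_gt0 dl0 (ltr0n _ 2))).
  pose K := maxn K0 N0.
  (* Deleting the coefficients in the [K] square turns partial sums into tails, whose weighted sums
     of squares are at most [eta]. *)
  pose c' j k := if (j <= K)%N && (k <= K)%N then 0 else c j k.
  have [||||A1 [mA1 muA1 HA1]] := @strong_weak_type _ _ _ mu
    (fun x j k => c' j k * psi j k x) (fun j k => c' j k ^+ 2) eta e.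
  - by move=> l h l' h' l0 l'0; exact: integrates_rect_sqr.
  - by move=> j k; exact: sqr_ge0.
  - move=> m n; apply: le_trans (HK0 K (leq_maxl _ _) m n).
    rewrite le_eqVlt; apply/orP; left; apply/eqP; apply: eq_rsum => j k.
    by rewrite /c'; case: ifP => // _; rewrite expr0n !mul0r.
  - exact: e0.
  pose f x := `|psum c psi K K x - g x| ^+ 2.
  have mf : measurable_fun setT f.
    apply: measurable_funX; apply: measurableT_comp => //.
    by apply: measurable_funB => //; exact: measurable_psum.
  have f0 x : 0 <= f x by exact: exprn_ge0.
  have fint := HN0 K K (leq_maxr _ _) (leq_maxr _ _).
  have muA2 := markov_le mf f0 e0 fint.
  have mA2 := measurable_ge e mf.
  exists (A1 `|` [set x | e <= f x])%classic; split.
  - exact: measurableU.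
  - move=> x /= bad; apply: contrapT => /not_orP[nA1 /negP]; rewrite -ltNge => fe.
    apply: bad; apply: (@cesaro_mean_eventually_le _ _ _ _ _ K) => //; last exact: ltW.
    move=> M N M0 N'0; apply: le_trans (HA1 x nA1 M N M0 N'0).
    rewrite le_eqVlt; apply/orP; left; apply/eqP; congr (_ * _).
    apply: eq_bigr => m _; apply: eq_bigr => n _; congr (_ ^+ 2); apply: eq_rsum => j k.
    by rewrite /c'; case: ifP => // _; rewrite mul0r.
  - apply: (le_trans (measureU2 _ mA1 mA2)).
    apply: (le_trans (leeD muA1 muA2)); rewrite -EFinD lee_fin le_eqVlt.
    apply/orP; left; apply/eqP; rewrite /eta; field.
    by rewrite gt_eqF.
(* Countably many tolerances [9 / (n + 1)] suffice: [n >= 9 / e] brings them below [e]. *)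
have : mu.-negligible (\bigcup_n [set x | ~ good (9 * n.+1%:R^-1) x])%classic.
  by apply: negligible_bigcup => n; apply: bad_negl; rewrite invr_gt0.
apply: negligibleS => x /= /existsNP[e /not_implyP[e0 bad]].
have eV0 : 0 <= 9 / e by rewrite divr_ge0 // ltW.
have /ltW eN := archi_boundP eV0.
exists (Num.bound (9 / e)) => //= -[N0 HN0]; apply: bad; exists N0 => M N NM NN.
apply: (le_trans (HN0 M N NM NN)); rewrite ler_pdivrMr // mulrC -ler_pdivrMr //.
by rewrite (le_trans eN) // ler_nat.
Qed.
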